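(* Let $d$ be a fixed positive integer. For each $n$, let $X_n$ be the random variable counting the $d$-descents of a uniformly random permutation of $\{1,2,\dots,n\}$. Then, as $n\to\infty$, the standardized variable $\tilde{X}_n=(X_n-E(X_n))/\sqrt{\mathrm{Var}(X_n)}$ converges in distribution to the standard normal distribution $N(0,1)$.
   Context: For a permutation $p=p_1p_2\cdots p_n$ of $\{1,\dots,n\}$ and a positive integer $d$, a pair of indices $(i,j)$ with $1\le i<j\le n$ is called a $d$-descent of $p$ if $j\le i+d$ and $p_i>p_j$. For a random variable $Z$ with finite positive variance, $\tilde{Z}=(Z-E(Z))/\sqrt{\mathrm{Var}(Z)}$. (The variance of $X_n$ is positive for $n\ge 2$, so the definition of $\tilde X_n$ makes sense for such $n$.) *)

(* Defs.v *)
From HB Require Import structures.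
From mathcomp Require Import all_boot all_order all_algebra perm finmap.
From mathcomp Require Import all_classical all_reals all_analysis.
From mathcomp Require Import measurable_realfun.

Set Implicit Arguments.
Unset Strict Implicit.
Unset Printing Implicit Defensive.

Import Order.TTheory GRing.Theory Num.Theory.
Import numFieldNormedType.Exports.

Local Open Scope classical_set_scope.
Local Open Scope ring_scope.

HB.instance Definition _ (T : finType) :=
  isPointed.Build (perm_type T) (perm_one T).
HB.instance Definition _ (T : finType) :=
  @isMeasurable.Build default_measure_display (perm_type T)
    discrete_measurable discrete_measurable0
    discrete_measurableC discrete_measurableU.

Lemma counting_finset (R : realType) (T : finType) (A : {set T}) :
  counting [set` A] = #|A|%:R%:E :> \bar R.
Proof.
have -> : [set` A] = [set` [fset x in enum A]%fset].
  by apply/seteqP; split=> x /=; rewrite in_fset /= mem_enum.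
rewrite /counting (asboolT (finite_fset _)) set_fsetK.
by rewrite card_fseq undup_id ?enum_uniq// -cardE.
Qed.

Section uniform_perm.
Context (R : realType) (n : nat).

Definition uniform_perm : set 'S_n -> \bar R :=
  mscale (n`!%:R^-1)%:nng counting.

HB.instance Definition _ := Measure.on uniform_perm.

Lemma uniform_permE (A : {set 'S_n}) :
  uniform_perm [set` A] = (#|A|%:R / n`!%:R)%:E.
Proof.
transitivity (n`!%:R^-1%:E * @counting _ R [set` A])%E; first by [].
by rewrite counting_finset -EFinM mulrC.
Qed.

Let uniform_perm_setT : uniform_perm [set: 'S_n] = 1%E.
Proof.
have -> : [set: 'S_n] = [set` [set: 'S_n]%SET].
  by apply/seteqP; split=> x //= _; rewrite inE.
by rewrite uniform_permE cardsT card_Sn divff// pnatr_eq0 -lt0n fact_gt0.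
Qed.

HB.instance Definition _ :=
  Measure_isProbability.Build _ _ R uniform_perm uniform_perm_setT.

End uniform_perm.
Arguments uniform_perm R n A : clear implicits.

(* Indices and values are shifted by one: both range over {0, ..., n - 1}. *)
Definition dDescents (d n : nat) (p : 'S_n) : {set 'I_n * 'I_n} :=
  [set ij : 'I_n * 'I_n |
    [&& (ij.1 < ij.2)%N, (ij.2 <= ij.1 + d)%N & (p ij.2 < p ij.1)%N]]%SET.

Definition num_dDescents (R : realType) (d n : nat) (p : 'S_n) : R :=
  #|dDescents d p|%:R.
Arguments num_dDescents R d n p : clear implicits.

HB.instance Definition _ (R : realType) (d n : nat) :=
  isMeasurableFun.Build _ _ 'S_n R (num_dDescents R d n)
    (fun _ _ _ => I).

Section standardize.
Context d (T : measurableType d) (R : realType) (P : probability T R).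

(* `fine` projects the extended-real expectation and variance to `R`. If the
   variance vanishes, the value is 0, since `x / 0 = 0`. *)
Definition standardize (X : {RV P >-> R}) : T -> R :=
  fun w => (X w - fine 'E_P[X]) / Num.sqrt (fine 'V_P[X]).

Let measurable_standardize (X : {RV P >-> R}) :
  measurable_fun [set: T] (standardize X).
Proof. by apply: measurable_funM => //; exact: measurable_funB. Qed.

HB.instance Definition _ (X : {RV P >-> R}) :=
  isMeasurableFun.Build _ _ T R (standardize X) (measurable_standardize X).

End standardize.
Arguments standardize {d T R} P X w.

(* `P` is an explicit argument because `{RV P >-> R}` unfolds to a type of
   measurable functions in which `P` no longer occurs. Convergence of the
   distribution functions is required exactly at the continuity points of the
   limiting one. *)
Definition cvg_in_distribution (R : realType) (disp : nat -> measure_display)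
    (T : forall n, measurableType (disp n)) (P : forall n, probability (T n) R)
    (X : forall n, {RV (P n) >-> R})
    (mu : probability (measurableTypeR R) R) : Prop :=
  forall x : R, {for x, continuous (fun t : R => mu [set` `]-oo, t]])} ->
    @cdf _ _ _ (P n) (X n) x @[n --> \oo] --> mu [set` `]-oo, x]].
Arguments cvg_in_distribution {R disp T} P X mu.

(* Main.v *)
(* Stein's method for a sum with local dependence. Let [W] be the centered
   number of d-descents divided by its standard deviation [s], and write the
   numerator as a sum of [xi a = 1{p_j < p_i} - 1/2] over the pairs
   [a = (i, j)] with [i < j <= i + d]. Exchanging [p_i] and [p_j] flips the sign
   of [xi a], so [xi a] is orthogonal to every function of the other entries;
   and the products [xi a * xi b] have a computable mean, even conditionally on
   the entries away from [a] and [b]. This makes [s ^ 2] at least linear in [n]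
   and bounds [E (f' W - W f W)] by [O(1 / s)] whenever [f'] is bounded and
   Lipschitz. For [g] Lipschitz with compact support and Gaussian mean zero, the
   solution [f] of [f' x - x f x = g x] also has compact support, hence
   [E (g W)] tends to 0. The mean zero condition is removed by subtracting a
   multiple of a wide trapezoid, whose mean is close to 1 by Chebyshev's
   inequality, and two trapezoids squeeze the distribution function. *)

From HB Require Import structures.
Require Import Defs.
From mathcomp Require Import all_boot all_order all_algebra perm.
From mathcomp Require Import all_classical all_reals all_analysis.
From mathcomp Require Import measurable_realfun ring lra zify.

Set Implicit Arguments.
Unset Strict Implicit.
Unset Printing Implicit Defensive.

Import Order.TTheory GRing.Theory Num.Theory.
Import numFieldNormedType.Exports.

Local Open Scope ring_scope.

(** * Comparisons of entries of a random permutation *)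

Section permutation_mean.
Variables (R : realFieldType) (n : nat).
Implicit Types (F G : 'S_n -> R) (i j k : 'I_n) (a b c e : 'I_n * 'I_n).

Definition mean F : R := (\sum_p F p) / n`!%:R.

Lemma meanD F G : mean (fun p => F p + G p) = mean F + mean G.
Proof. by rewrite /mean big_split mulrDl. Qed.

Lemma meanZ (x : R) F : mean (fun p => x * F p) = x * mean F.
Proof. by rewrite /mean -mulr_sumr mulrA. Qed.

Lemma meanZr (x : R) F : mean (fun p => F p * x) = mean F * x.
Proof. by rewrite /mean -mulr_suml mulrAC. Qed.

Lemma meanN F : mean (fun p => - F p) = - mean F.
Proof. by rewrite /mean sumrN mulNr. Qed.

Lemma meanB F G : mean (fun p => F p - G p) = mean F - mean G.
Proof. by rewrite meanD meanN. Qed.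

Lemma mean_sum (I : Type) (r : seq I) (P : pred I) (F : I -> 'S_n -> R) :
  mean (fun p => \sum_(a <- r | P a) F a p) = \sum_(a <- r | P a) mean (F a).
Proof. by rewrite /mean exchange_big /= mulr_suml. Qed.

Lemma eq_mean F G : F =1 G -> mean F = mean G.
Proof. by move=> FG; rewrite /mean; under eq_bigr do rewrite FG. Qed.

Lemma le_mean F G : (forall p, F p <= G p) -> mean F <= mean G.
Proof.
by move=> FG; rewrite ler_wpM2r ?invr_ge0 ?ler0n// ler_sum// => p _.
Qed.

Lemma mean_cst (x : R) : mean (fun=> x) = x.
Proof.
rewrite /mean sumr_const -[#|_|]/#|{: 'S_n}| card_Sn.
by rewrite -[x *+ _]mulr_natr mulfK// pnatr_eq0 -lt0n fact_gt0.
Qed.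

Lemma ler_norm_mean F : `|mean F| <= mean (fun p => `|F p|).
Proof.
rewrite normrM (ger0_norm (x := _^-1)) ?invr_ge0 ?ler0n//.
by rewrite ler_wpM2r ?invr_ge0 ?ler0n// ler_norm_sum.
Qed.

(** Since [(s * p) i = p (s i)], left translation rearranges positions rather than values. *)
Lemma mean_translate (s : 'S_n) F : mean (fun p => F (s * p)%g) = mean F.
Proof. by rewrite /mean [in RHS](reindex_inj (mulgI s)). Qed.

(** Centering at 1/2 makes comparisons of distinct positions antisymmetric, with values 1/2 and
    -1/2. *)
Definition cmp i j (p : 'S_n) : R := (p j < p i)%N%:R - 2^-1.

Lemma cmp_anti i j p : i != j -> cmp j i p = - cmp i j p.
Proof.
move=> ij; have : val (p i) != p j.
  by rewrite (inj_eq val_inj) (inj_eq perm_inj).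
by rewrite /cmp; case: ltngtP => //= _ _; lra.
Qed.

Lemma cmp_sqr i j p : cmp i j p * cmp i j p = 4^-1.
Proof. by rewrite /cmp; case: ltnP => _ /=; lra. Qed.

Lemma norm_cmp i j p : `|cmp i j p| = 2^-1.
Proof.
rewrite /cmp; case: ltnP => _ /=; last by rewrite sub0r normrN ger0_norm; lra.
by rewrite ger0_norm; lra.
Qed.

Lemma cmp_translate i j (s p : 'S_n) : cmp i j (s * p)%g = cmp (s i) (s j) p.
Proof. by rewrite /cmp !permM. Qed.

(** Translation by [tperm i j] preserves the mean and [F] but flips [cmp i j], so the mean equals
    its opposite. *)
Lemma mean_cmp i j F : i != j -> (forall p, F (tperm i j * p)%g = F p) ->
  mean (fun p => cmp i j p * F p) = 0.
Proof.
move=> ij Fij.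
set m := mean _; suff : m = - m by lra.
rewrite /m -[LHS](mean_translate (tperm i j)) -meanN; apply: eq_mean => p.
by rewrite Fij cmp_translate tpermL tpermR cmp_anti// mulNr.
Qed.

(* Of three distinct values exactly one is the median, hence the sum of the
   three products of comparisons based at each of them is always 1/4. *)
Lemma mean_cmp_cmp i j k F : i != j -> i != k -> j != k ->
  (forall p, F (tperm i j * p)%g = F p) ->
  (forall p, F (tperm i k * p)%g = F p) ->
  mean (fun p => cmp i j p * cmp i k p * F p) = 12^-1 * mean F.
Proof.
move=> ij ik jk Fij Fik.
set A := LHS.
(* The two transpositions carry the product based at [i] to those based at [j] and [k], so all three
   have the same mean. *)
have Aj : A = mean (fun p => cmp j i p * cmp j k p * F p).
  rewrite /A -(mean_translate (tperm i j)); apply: eq_mean => p.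
  by rewrite Fij !cmp_translate tpermL tpermR tpermD.
have Ak : A = mean (fun p => cmp k j p * cmp k i p * F p).
  rewrite /A -(mean_translate (tperm i k)); apply: eq_mean => p.
  by rewrite Fik !cmp_translate tpermL tpermR tpermD// eq_sym.
suff : A + A + A = 4^-1 * mean F by lra.
rewrite {2}Aj {2}Ak /A -!meanD -meanZ; apply: eq_mean => p; rewrite -!mulrDl.
congr (_ * _); rewrite (cmp_anti p ij) (cmp_anti p jk) (cmp_anti p ik).
have : val (p i) != p j by rewrite (inj_eq val_inj) (inj_eq perm_inj).
have : val (p i) != p k by rewrite (inj_eq val_inj) (inj_eq perm_inj).
have : val (p j) != p k by rewrite (inj_eq val_inj) (inj_eq perm_inj).
rewrite /cmp; case: (ltngtP (p j) (p i)) => //;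
  case: (ltngtP (p k) (p i)) => //;
  case: (ltngtP (p k) (p j)) => //= *; try lra; exfalso; lia.
Qed.

(** The dependency graph of the comparisons; every pair is adjacent to itself. *)
Definition adj a b :=
  [|| a.1 == b.1, a.1 == b.2, a.2 == b.1 | a.2 == b.2].

Lemma adjC a b : adj a b = adj b a.
Proof.
rewrite /adj (eq_sym b.1) (eq_sym b.1 a.2) (eq_sym b.2) (eq_sym b.2 a.2).
by do !case: eqP.
Qed.

Definition xi a := cmp a.1 a.2.

Definition oriented a := (a.1 < a.2)%N.

Lemma oriented_neq a : oriented a -> a.1 != a.2.
Proof. by move=> aa; rewrite -(inj_eq val_inj) ltn_eqF. Qed.

(** As [c] may be a diagonal pair [(v, v)], such an [s] fixes every index that is not an end of [a]
    or [b]. Invariance under all such [s] replaces conditioning on the entries away from [a] and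
    [b]. *)
Definition on_edges a b (s : 'S_n) := forall c, ~~ adj a c -> ~~ adj b c ->
  s c.1 = c.1 /\ s c.2 = c.2.

Definition invariant_on a b F := forall s, on_edges a b s ->
  forall p, F (s * p)%g = F p.

Lemma on_edges_tperm a b i j : (i \in [:: a.1; a.2; b.1; b.2]) ->
  (j \in [:: a.1; a.2; b.1; b.2]) -> on_edges a b (tperm i j).
Proof.
rewrite !inE => iab jab c; rewrite /adj !negb_or.
move=> /and4P[a1 a2 a3 a4] /and4P[b1 b2 b3 b4].
split; rewrite tpermD//.
- by case/or4P: iab => /eqP ->.
- by case/or4P: jab => /eqP ->.
- by case/or4P: iab => /eqP ->.
- by case/or4P: jab => /eqP ->.
Qed.

Lemma invariant_on_xi a b c : ~~ adj a c -> ~~ adj b c ->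
  invariant_on a b (xi c).
Proof.
move=> ac bc s sab p; rewrite /xi cmp_translate.
by have [-> ->] := sab c ac bc.
Qed.

(** The covariance of [xi a] and [xi b] for oriented pairs. For [a = b] it is 3/12, the variance 1/4
    of a fair indicator. *)
Definition kappa a b : R :=
  ((a.1 == b.1)%:R + (a.2 == b.2)%:R - (a.1 == b.2)%:R - (a.2 == b.1)%:R
   + (a == b)%:R) / 12.

Lemma kappa_nadj a b : ~~ adj a b -> kappa a b = 0.
Proof.
rewrite /adj !negb_or => /and4P[a1 a2 a3 a4]; rewrite /kappa.
have -> : (a == b) = false by apply: contraNF a1 => /eqP ->.
by rewrite (negbTE a1) (negbTE a2) (negbTE a3) (negbTE a4) /=; lra.
Qed.

(** When distinct pairs share an index, reorienting them with [cmp_anti] bases both comparisons at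
    it and [mean_cmp_cmp] applies; each reorientation changes the sign. *)
Lemma mean_xi_xi a b F : oriented a -> oriented b -> invariant_on a b F ->
  mean (fun p => xi a p * xi b p * F p) = kappa a b * mean F.
Proof.
move=> oa ob Fab.
have ha := oriented_neq oa; have hb := oriented_neq ob.
have Ft i j : (i \in [:: a.1; a.2; b.1; b.2]) ->
    (j \in [:: a.1; a.2; b.1; b.2]) -> forall p, F (tperm i j * p)%g = F p.
  by move=> iab jab; apply: Fab; exact: on_edges_tperm.
(* For disjoint pairs, exchanging the ends of [a] flips [xi a] and leaves [xi b] alone. *)
have [ab|nab] := boolP (adj a b); last first.
  rewrite kappa_nadj// mul0r.
  under eq_mean do rewrite -mulrA.
  apply: mean_cmp => // p.
  rewrite Ft ?inE ?eqxx ?orbT//; congr (_ * _).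
  move: nab; rewrite /adj !negb_or => /and4P[a1 a2 a3 a4].
  by rewrite /xi cmp_translate !tpermD.
have [eab|nab] := eqVneq a b.
  subst b; under eq_mean do rewrite /xi cmp_sqr.
  rewrite meanZ; congr (_ * _); rewrite /kappa !eqxx (negbTE ha).
  by rewrite eq_sym (negbTE ha) /=; lra.
case: a b oa ob ha hb Fab Ft ab nab => [i j] [k l]; rewrite /oriented/=.
move=> ij kl ni nk Fab Ft ab nab.
rewrite xpair_eqE in nab; rewrite /adj/= in ab; rewrite /xi /kappa/= xpair_eqE.
have [ik|ik] := eqVneq i k.
  subst k; rewrite eqxx/= in nab; rewrite (negbTE nab) (negbTE nk).
  rewrite (eq_sym j i) (negbTE ni) mean_cmp_cmp//.
  - by congr (_ * _) => /=; lra.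
  - by apply: Ft; rewrite !inE eqxx ?orbT.
  - by apply: Ft; rewrite !inE eqxx ?orbT.
have [jl|jl] := eqVneq j l.
  subst l; rewrite (negbTE ni) (eq_sym j k) (negbTE nk)/=.
  under eq_mean => p.
    rewrite -(opprK (cmp i j p)) -(cmp_anti p ni).
    rewrite -(opprK (cmp k j p)) -(cmp_anti p nk) mulrNN; over.
  rewrite mean_cmp_cmp//.
  - by congr (_ * _) => /=; lra.
  - by rewrite eq_sym.
  - by rewrite eq_sym.
  - by apply: Ft; rewrite !inE eqxx ?orbT.
  - by apply: Ft; rewrite !inE eqxx ?orbT.
have [il|il] := eqVneq i l.
  (* Both pairs are increasing, so [j = k] would give [i < j = k < i]. *)
  subst l; have jk : j != k.
    by apply: contraTneq ij => ->; rewrite -leqNgt ltnW.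
  rewrite (negbTE jk)/=.
  under eq_mean => p do rewrite (cmp_anti p ik) mulrN mulNr.
  rewrite meanN mean_cmp_cmp//.
  - by rewrite -mulNr; congr (_ * _) => /=; lra.
  - by apply: Ft; rewrite !inE eqxx ?orbT.
  - by apply: Ft; rewrite !inE eqxx ?orbT.
have jk : j = k.
  by move: ab; rewrite (negbTE ik) (negbTE il) (negbTE jl) orbF => /eqP.
subst k; rewrite eqxx/=.
under eq_mean => p do rewrite -(opprK (cmp i j p)) -(cmp_anti p ni) !mulNr.
rewrite meanN mean_cmp_cmp//.
- by rewrite -mulNr; congr (_ * _) => /=; lra.
- by rewrite eq_sym.
- by apply: Ft; rewrite !inE eqxx ?orbT.
- by apply: Ft; rewrite !inE eqxx ?orbT.
Qed.

End permutation_mean.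

(** * Stein's bound for sums of comparisons *)

Section comparison_sum.
Variables (R : realFieldType) (n D : nat) (E : {set 'I_n * 'I_n}).
Hypothesis E_oriented : forall a, a \in E -> oriented a.
Hypothesis E_degree : forall a, (\sum_(b in E | adj a b) 1 <= D)%N.
Implicit Types a b c e : 'I_n * 'I_n.

Local Notation xi := (@xi R n).
Local Notation kappa := (@kappa R n).

Definition cmp_sum (p : 'S_n) : R := \sum_(a in E) xi a p.

Definition cmp_var : R := \sum_(a in E) \sum_(b in E) kappa a b.

Lemma mean_xi a : oriented a -> mean (xi a) = 0.
Proof.
move=> /oriented_neq ha; rewrite -(mean_cmp (F := fun=> 1) ha)//.
by apply: eq_mean => p; rewrite mulr1.
Qed.

Lemma mean_xi2 a b : oriented a -> oriented b ->
  mean (fun p => xi a p * xi b p) = kappa a b.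
Proof.
move=> oa ob; rewrite -[RHS]mulr1 -(mean_cst n (1 : R)) -mean_xi_xi//.
by apply: eq_mean => p; rewrite mulr1.
Qed.

Lemma mean_cmp_sum : mean cmp_sum = 0.
Proof. by rewrite mean_sum big1// => a aE; rewrite mean_xi// E_oriented. Qed.

Lemma mean_cmp_sum2 : mean (fun p => cmp_sum p * cmp_sum p) = cmp_var.
Proof.
under eq_mean do rewrite mulr_suml.
rewrite mean_sum; apply: eq_bigr => a aE.
under eq_mean do rewrite mulr_sumr.
by rewrite mean_sum; apply: eq_bigr => b bE; rewrite mean_xi2 ?E_oriented.
Qed.

(* Up to the diagonal term, [kappa a b] is a twelfth of the scalar product of
   the incidence vectors [delta_(a.1) - delta_(a.2)] of the edges. *)
Lemma cmp_var_ge : #|E|%:R / 12 <= cmp_var.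
Proof.
pose inc a (v : 'I_n) : R := (v == a.1)%:R - (v == a.2)%:R.
have incE a b : \sum_v inc a v * inc b v = (a.1 == b.1)%:R + (a.2 == b.2)%:R
    - (a.1 == b.2)%:R - (a.2 == b.1)%:R.
  have sumE (i j : 'I_n) : \sum_v (v == i)%:R * (v == j)%:R = (i == j)%:R :> R.
    rewrite (bigD1 i)//= eqxx mul1r big1 ?addr0// => v /negbTE ->.
    by rewrite mul0r.
  rewrite -!sumE -!sumrN -!big_split/=; apply: eq_bigr => v _.
  by rewrite /inc; ring.
(* The scalar products add up to the squared norm of the total incidence vector; the diagonal terms
   give the lower bound. *)
have -> : cmp_var =
    (\sum_v (\sum_(a in E) inc a v) ^+ 2) / 12 + #|E|%:R / 12.
  transitivity (\sum_(a in E) \sum_(b in E)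
      ((\sum_v inc a v * inc b v) / 12 + (a == b)%:R / 12)).
    by apply: eq_bigr => a _; apply: eq_bigr => b _; rewrite incE -mulrDl.
  under eq_bigr do rewrite big_split/=.
  rewrite big_split/=; congr (_ + _).
    under eq_bigr do rewrite -mulr_suml exchange_big/=.
    rewrite -mulr_suml exchange_big/=; congr (_ / _); apply: eq_bigr => v _.
    rewrite expr2 mulr_suml; apply: eq_bigr => a _.
    by rewrite mulr_sumr.
  under eq_bigr do rewrite -mulr_suml.
  rewrite -mulr_suml; congr (_ / _).
  rewrite -sum1_card natr_sum; apply: eq_bigr => a aE.
  rewrite (bigD1 a)//= eqxx big1 ?addr0// => b /andP[_].
  by rewrite eq_sym => /negbTE ->.
rewrite lerDr mulr_ge0 ?invr_ge0 ?ler0n//.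
by apply: sumr_ge0 => v _; exact: sqr_ge0.
Qed.

Definition near_sum a p : R := \sum_(b in E | adj a b) xi b p.

Lemma norm_near_sum a p : `|near_sum a p| <= D%:R / 2.
Proof.
apply: le_trans (ler_norm_sum _ _ _) _.
rewrite (eq_bigr (fun=> 2^-1)); last by move=> b _; rewrite norm_cmp.
have -> : \sum_(b in E | adj a b) 2^-1 =
    (\sum_(b in E | adj a b) 1)%N%:R / 2 :> R.
  by rewrite natr_sum mulr_suml; apply: eq_bigr => b _; rewrite mul1r.
by rewrite ler_pM2r ?invr_gt0 ?ltr0n// ler_nat E_degree.
Qed.

Lemma far_sumE a p :
  cmp_sum p - near_sum a p = \sum_(b in E | ~~ adj a b) xi b p.
Proof. by rewrite /cmp_sum (bigID (adj a))/= addrAC subrr add0r. Qed.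

(** The far sum involves neither end of [a], so exchanging these ends changes only the sign of
    [xi a]. *)
Lemma mean_xi_far a (h : R -> R) : oriented a ->
  mean (fun p => xi a p * h (cmp_sum p - near_sum a p)) = 0.
Proof.
move=> /oriented_neq ha; apply: mean_cmp => // p; congr h.
rewrite !far_sumE; apply: eq_bigr => b /andP[_ ab].
apply: (@invariant_on_xi _ _ a a) => //.
by apply: on_edges_tperm; rewrite !inE eqxx ?orbT.
Qed.

(** The part of the expansion of [cmp_sum p ^+ 2] carried by adjacent pairs. It has mean [cmp_var],
    since [kappa] vanishes on the others. *)
Definition local_sq p : R := \sum_(a in E) xi a p * near_sum a p.

Definition xi2_dev a b p := xi a p * xi b p - kappa a b.

Lemma local_sqB p :
  local_sq p - cmp_var = \sum_(a in E) \sum_(b in E | adj a b) xi2_dev a b p.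
Proof.
rewrite /local_sq /cmp_var -sumrB; apply: eq_bigr => a _.
rewrite /near_sum mulr_sumr [X in _ - X](bigID (adj a))/=.
rewrite [X in _ - (_ + X)]big1.
  by rewrite addr0 -sumrB.
by move=> b /andP[_]; exact: kappa_nadj.
Qed.

Lemma norm_xi2_dev a b p : oriented a -> oriented b -> `|xi2_dev a b p| <= 1.
Proof.
move=> oa ob; have x4 q : `|xi a q * xi b q| = 4^-1.
  by rewrite normrM !norm_cmp; lra.
have k4 : `|kappa a b| <= 4^-1.
  rewrite -mean_xi2//; apply: le_trans (ler_norm_mean _) _.
  by under eq_mean do rewrite x4; rewrite mean_cst.
by apply: le_trans (ler_normB _ _) _; rewrite x4; lra.
Qed.

Definition overlap a b c e := [|| adj a c, adj a e, adj b c | adj b e].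

(** The second deviation is invariant under rearranging the ends of [a] and [b], and [xi a * xi b]
    still averages to [kappa a b] against such a function. *)
Lemma mean_xi2_dev a b c e : oriented a -> oriented b -> oriented c ->
  oriented e -> ~~ overlap a b c e ->
  mean (fun p => xi2_dev a b p * xi2_dev c e p) = 0.
Proof.
move=> oa ob oc oe /norP[ac /norP[ae /norP[bc be]]].
transitivity (mean (fun p =>
    xi a p * xi b p * xi2_dev c e p - kappa a b * xi2_dev c e p)).
  by apply: eq_mean => p; rewrite -mulrBl.
rewrite meanB meanZ mean_xi_xi ?subrr// => s sab p.
by rewrite /xi2_dev (invariant_on_xi R ac bc sab) (invariant_on_xi R ae be sab).
Qed.

(** Each of the four adjacencies in [overlap] leaves at most [D] choices for one of [c], [e], and
    then at most [D] for the other. *)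
Lemma sum_overlap a b :
  (\sum_(c in E) \sum_(e in E | adj c e) overlap a b c e <= 4 * D ^ 2)%N.
Proof.
have sum1 x : (\sum_(c in E) \sum_(e in E | adj c e) adj x c <= D ^ 2)%N.
  apply: (@leq_trans (\sum_(c in E | adj x c) D)%N); last first.
    rewrite -[D in leqLHS]muln1 -big_distrr/= expnS expn1.
    by rewrite leq_mul2l E_degree orbT.
  rewrite [leqRHS]big_mkcondr/=; apply: leq_sum => c _.
  case: ifPn => [xc|_]; last by rewrite big1.
  exact: E_degree.
have sum2 x : (\sum_(c in E) \sum_(e in E | adj c e) adj x e <= D ^ 2)%N.
  apply: leq_trans (sum1 x); rewrite leq_eqVlt; apply/orP; left; apply/eqP.
  rewrite (exchange_big_dep (fun e => e \in E))/=; last by move=> ? ? _ /andP[].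
  by apply: eq_bigr => e eE; apply: eq_bigl => c; rewrite eE adjC.
apply: (@leq_trans (\sum_(c in E) \sum_(e in E | adj c e)
    (adj a c + adj a e + adj b c + adj b e))%N).
  apply: leq_sum => c _; apply: leq_sum => e _; rewrite /overlap.
  by do 4 case: adj.
under eq_bigr do rewrite !big_split/=.
rewrite !big_split/=.
by rewrite !mulSn mul0n addn0 !addnA !leq_add.
Qed.

(** In the expanded square only overlapping deviations contribute, each at most 1; there are at most
    [#|E| * D] choices of [(a, b)] and then [4 * D ^ 2] of [(c, e)]. *)
Lemma mean_local_sqB2 :
  mean (fun p => (local_sq p - cmp_var) ^+ 2) <= 4 * #|E|%:R * D%:R ^+ 3.
Proof.
apply: (@le_trans _ _ (\sum_(a in E) \sum_(b in E | adj a b)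
    \sum_(c in E) \sum_(e in E | adj c e) (overlap a b c e)%:R)).
  under eq_mean do rewrite local_sqB expr2 mulr_suml.
  rewrite mean_sum; apply: ler_sum => a aE.
  under eq_mean do rewrite mulr_suml.
  rewrite mean_sum; apply: ler_sum => b /andP[bE _].
  under eq_mean do rewrite mulr_sumr.
  rewrite mean_sum; apply: ler_sum => c cE.
  under eq_mean do rewrite mulr_sumr.
  rewrite mean_sum; apply: ler_sum => e /andP[eE _].
  have [_|abce] := boolP (overlap a b c e); last first.
    by rewrite mean_xi2_dev ?E_oriented.
  rewrite -[leRHS](mean_cst n); apply: le_mean => p.
  apply: le_trans (ler_norm _) _; rewrite normrM.
  by rewrite -[leRHS]mulr1 ler_pM ?norm_xi2_dev ?E_oriented.
apply: (@le_trans _ _ (\sum_(a in E) \sum_(b in E | adj a b)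
    (4 * D ^ 2)%N%:R)).
  apply: ler_sum => a aE; apply: ler_sum => b _.
  under eq_bigr do rewrite -natr_sum.
  by rewrite -natr_sum ler_nat sum_overlap.
under eq_bigr do
  rewrite -natr_sum -[X in (\sum_(_ in E | _) X)%N]mul1n -big_distrl/=.
rewrite -natr_sum -big_distrl/= -!natrX -!natrM ler_nat.
have h : (\sum_(a in E) \sum_(b in E | adj a b) 1 <= #|E| * D)%N.
  by rewrite -sum1_card big_distrl/=; apply: leq_sum => a _; rewrite mul1n.
apply: leq_trans (leq_mul h (leqnn _)) _.
by rewrite leq_eqVlt; apply/orP; left; apply/eqP; ring.
Qed.

Section stein_bound.
Variables (f f' : R -> R) (M s : R).
Hypothesis s_gt0 : 0 < s.
Hypothesis s2E : s ^+ 2 = cmp_var.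
Hypothesis M_ge0 : 0 <= M.
Hypothesis f'_bound : forall x, `|f' x| <= M.
Hypothesis f_taylor : forall x u, `|f x - f (x - u) - u * f' x| <= M * u ^+ 2.

Let s_neq0 : s != 0. Proof. by rewrite gt_eqF. Qed.

Local Notation W p := (cmp_sum p / s).

(** The inequality [x <= x ^+ 2 / (2 * s) + s / 2] stands in for Cauchy-Schwarz, and
    [#|E| <= 12 * s ^+ 2] turns the second moment bound into one linear in [s]. *)
Lemma mean_norm_local_sqB :
  mean (fun p => `|local_sq p - cmp_var|) <= (24 * D%:R ^+ 3 + 1) * s.
Proof.
have m12 : #|E|%:R <= 12 * s ^+ 2.
  by rewrite s2E; have := cmp_var_ge; lra.
apply: (@le_trans _ _ (mean (fun p =>
    (2 * s)^-1 * (local_sq p - cmp_var) ^+ 2 + s / 2))).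
  apply: le_mean => p; rewrite -[X in _ * X + _]real_normK ?num_real//.
  set x := `|_|.
  have : 0 <= (2 * s)^-1 * (x - s) ^+ 2.
    by rewrite mulr_ge0 ?sqr_ge0// invr_ge0 mulr_ge0// ltW.
  have -> : (2 * s)^-1 * (x - s) ^+ 2 = (2 * s)^-1 * x ^+ 2 + s / 2 - x.
    by field.
  by rewrite subr_ge0.
rewrite meanD mean_cst meanZ.
have D3 : 0 <= D%:R ^+ 3 :> R by rewrite exprn_ge0.
have : (2 * s)^-1 * mean (fun p => (local_sq p - cmp_var) ^+ 2) <=
    (2 * s)^-1 * (4 * (12 * s ^+ 2) * D%:R ^+ 3).
  rewrite ler_wpM2l ?invr_ge0//; first by rewrite mulr_ge0// ltW.
  apply: le_trans mean_local_sqB2 _.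
  by rewrite ler_wpM2r// ler_wpM2l.
have -> : (2 * s)^-1 * (4 * (12 * s ^+ 2) * D%:R ^+ 3) = 24 * D%:R ^+ 3 * s.
  by field.
by move=> h; rewrite [leRHS]mulrDl mul1r lerD//; move: s_gt0; lra.
Qed.

(** Two errors arise: the Taylor remainders when [near_sum a] is removed from the argument of [f],
    and the fluctuation of [local_sq] around [s ^+ 2]. *)
Lemma stein_bound :
  `|mean (fun p => f' (W p) - W p * f (W p))| <=
    M * (24 * D%:R ^+ 3 + 12 * D%:R ^+ 2 + 1) / s.
Proof.
have m12 : #|E|%:R <= 12 * s ^+ 2.
  by rewrite s2E; have := cmp_var_ge; lra.
(* The Taylor remainder of [f] at [W p] for the increment [near_sum a p / s], weighted by
   [xi a p]. *)
pose r a p := xi a p * (f (W p) - f ((cmp_sum p - near_sum a p) / s)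
                        - near_sum a p / s * f' (W p)).
have WfE : mean (fun p => W p * f (W p)) =
    s^-1 * \sum_(a in E) mean (r a) +
    s ^- 2 * mean (fun p => local_sq p * f' (W p)).
  transitivity (s^-1 * \sum_(a in E) (mean (r a) +
      s^-1 * mean (fun p => xi a p * near_sum a p * f' (W p)))).
    transitivity (mean (fun p => s^-1 * \sum_(a in E) xi a p * f (W p))).
      by apply: eq_mean => p; rewrite -mulr_suml -/(cmp_sum p); ring.
    rewrite meanZ; congr (_ * _); rewrite mean_sum; apply: eq_bigr => a aE.
    (* Subtracting a vanishing mean replaces [f (W p)] by its increment from the far sum. *)
    rewrite -[LHS]subr0 -(mean_xi_far (fun x => f (x / s)) (E_oriented aE)).
    rewrite -meanB -meanZ -meanD; apply: eq_mean => p.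
    by rewrite /r; ring.
  rewrite big_split/= mulrDr; congr (_ + _).
  rewrite -mulr_sumr -mean_sum mulrA -invfM -expr2; congr (_ * _).
  by apply: eq_mean => p; rewrite /local_sq mulr_suml.
have rb a : mean (fun p => `|r a p|) <= M * D%:R ^+ 2 / s ^+ 2.
  rewrite -[leRHS](mean_cst n); apply: le_mean => p.
  rewrite /r normrM norm_cmp mulrBl.
  apply: (@le_trans _ _ (1 * (M * (near_sum a p / s) ^+ 2))).
    by rewrite ler_pM//; lra.
  rewrite mul1r -mulrA ler_wpM2l// expr_div_n ler_pM2r ?invr_gt0 ?exprn_gt0//.
  rewrite -real_normK ?num_real// lerXn2r ?nnegrE//.
  by apply: le_trans (norm_near_sum _ _) _; rewrite ler_piMr//; lra.
have -> : mean (fun p => f' (W p) - W p * f (W p)) =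
    - (s ^- 2 * mean (fun p => (local_sq p - cmp_var) * f' (W p)))
    - s^-1 * \sum_(a in E) mean (r a).
  have -> : mean (fun p => (local_sq p - cmp_var) * f' (W p)) =
      mean (fun p => local_sq p * f' (W p)) - s ^+ 2 * mean (fun p => f' (W p)).
    by rewrite -meanZ -meanB s2E; apply: eq_mean => p; rewrite mulrBl.
  by rewrite meanB WfE; field.
apply: le_trans (ler_normB _ _) _.
rewrite normrN (normrM (s ^- 2)) (normrM s^-1).
rewrite (gtr0_norm (x := s^-1)) ?invr_gt0//.
rewrite (gtr0_norm (x := s ^- 2)) ?invr_gt0 ?exprn_gt0//.
have h1 : `|mean (fun p => (local_sq p - cmp_var) * f' (W p))| <=
    (24 * D%:R ^+ 3 + 1) * s * M.
  apply: le_trans (ler_norm_mean _) _.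
  apply: (@le_trans _ _ (mean (fun p => `|local_sq p - cmp_var| * M))).
    by apply: le_mean => p; rewrite normrM ler_wpM2l.
  by rewrite meanZr ler_wpM2r// mean_norm_local_sqB.
(* There are at most [12 * s ^+ 2] remainders, each of order [s ^- 2], so their sum is bounded
   independently of [s]. *)
have h2 : `|\sum_(a in E) mean (r a)| <= 12 * (M * D%:R ^+ 2).
  apply: le_trans (ler_norm_sum _ _ _) _.
  apply: (@le_trans _ _ (\sum_(a in E) (M * D%:R ^+ 2 / s ^+ 2))).
    by apply: ler_sum => a _; apply: le_trans (ler_norm_mean _) _.
  rewrite sumr_const -[leLHS]mulr_natr.
  have MD : 0 <= M * D%:R ^+ 2 by rewrite mulr_ge0// exprn_ge0.
  apply: (@le_trans _ _ (M * D%:R ^+ 2 / s ^+ 2 * (12 * s ^+ 2))).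
    by rewrite ler_wpM2l// divr_ge0// exprn_ge0// ltW.
  by rewrite le_eqVlt; apply/orP; left; apply/eqP; field.
have s1 : 0 <= s^-1 by rewrite invr_ge0 ltW.
have s2 : 0 <= s ^- 2 by rewrite invr_ge0 exprn_ge0// ltW.
apply: le_trans (lerD (ler_wpM2l s2 h1) (ler_wpM2l s1 h2)) _.
by rewrite le_eqVlt; apply/orP; left; apply/eqP; field.
Qed.

End stein_bound.

End comparison_sum.

(** * Stein's equation *)

Section real_analysis.
Variable R : realType.
Implicit Types (F g : R -> R) (A L M x y u : R).
Local Open Scope classical_set_scope.

Lemma compact_support_bounded F A : continuous F ->
  (forall x, A <= `|x| -> F x = 0) ->
  exists2 M, 0 <= M & forall x, `|F x| <= M.
Proof.
move=> cF F0; have [A0|A0] := leP A 0.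
  by exists 0 => // x; rewrite F0 ?normr0// (le_trans A0).
have AA : - A <= A by lra.
have cN : {within `[- A, A], continuous (fun x => `|F x|)}.
  apply: continuous_subspaceT => x; apply: cvg_norm; exact: cF.
have [c cA Mc] := EVT_max AA cN.
exists `|F c| => // x; have [Ax|] := leP A `|x|; first by rewrite F0// normr0.
by move=> xA; apply: Mc; rewrite in_itv/= -ler_norml ltW.
Qed.

Lemma lipschitz_continuous L F : (forall x y, `|F x - F y| <= L * `|x - y|) ->
  continuous F.
Proof.
move=> LF x; apply/cvgrPdist_lt => e e0.
(* The sign of [L] is unknown; [|L| + 1] is a positive Lipschitz constant. *)
have L1 : 0 < `|L| + 1 by rewrite ltr_wpDl.
near=> y; apply: (le_lt_trans (LF x y)).
apply: (@le_lt_trans _ _ ((`|L| + 1) * `|x - y|)).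
  by rewrite ler_wpM2r// (le_trans (ler_norm L)) ?lerDl.
rewrite mulrC -ltr_pdivlMr//; near: y.
by apply: cvgr_dist_lt; [exact: cvg_id|rewrite divr_gt0].
Unshelve. all: by end_near. Qed.

Lemma is_derive_continuous F F' : (forall x, is_derive x 1 F (F' x)) ->
  continuous F.
Proof.
by move=> dF x; apply/differentiable_continuous/derivable1_diffP; case: (dF x).
Qed.

(** A form without an order between [x] and [y], keeping only the distance from [c] to [x] that the
    Taylor bound uses. *)
Lemma mean_value F F' : (forall x, is_derive x 1 F (F' x)) -> forall x y,
  exists2 c, `|c - x| <= `|x - y| & F x - F y = F' c * (x - y).
Proof.
move=> dF x y.
have cF a b : {within `[a, b], continuous F}.
  by apply: continuous_subspaceT; exact: is_derive_continuous dF.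
have [xy|/ltW yx] := leP x y.
  have [c + Fc] := MVT_segment xy (fun x _ => dF x) (@cF x y).
  rewrite in_itv/= => /andP[xc cy]; exists c; last first.
    by rewrite -opprB Fc -mulrN opprB.
  by rewrite (distrC x) !ger0_norm ?subr_ge0// lerD2r.
have [c + Fc] := MVT_segment yx (fun x _ => dF x) (@cF y x).
rewrite in_itv/= => /andP[yc cx]; exists c => //.
by rewrite distrC !ger0_norm ?subr_ge0// lerD2l lerN2.
Qed.

Lemma derive_bounded_lipschitz F F' M : (forall x, is_derive x 1 F (F' x)) ->
  (forall x, `|F' x| <= M) -> forall x y, `|F x - F y| <= M * `|x - y|.
Proof.
move=> dF F'M x y; have [c _ ->] := mean_value dF x y.
by rewrite normrM ler_wpM2r.
Qed.

Lemma taylor_lipschitz F F' M : 0 <= M -> (forall x, is_derive x 1 F (F' x)) ->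
  (forall x y, `|F' x - F' y| <= M * `|x - y|) ->
  forall x u, `|F x - F (x - u) - u * F' x| <= M * u ^+ 2.
Proof.
move=> M0 dF LF' x u; have [c cx ->] := mean_value dF x (x - u).
rewrite subKr in cx *.
rewrite (mulrC (F' c)) -mulrBr normrM -(real_normK (num_real u)) expr2 mulrCA.
rewrite ler_wpM2l// (le_trans (LF' _ _))// ler_wpM2l//.
Qed.

Local Notation mu := (@lebesgue_measure R).
Local Notation phi := (@normal_pdf R 0 1).

Lemma normal_pdf01E x :
  phi x = normal_peak 1 * expR (- x ^+ 2 / 2).
Proof.
by rewrite normal_pdfE ?oner_neq0// /normal_fun subr0 expr1n.
Qed.

Lemma normal_pdf01_gt0 x : 0 < phi x.
Proof.
by rewrite normal_pdf01E mulr_gt0 ?expR_gt0 ?normal_peak_gt0 ?oner_neq0.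
Qed.

Lemma is_derive_normal_pdf01 x : is_derive x 1 phi (- x * phi x).
Proof.
have -> : phi = (fun x => normal_peak 1 * expR (- x ^+ 2 / 2)).
  by apply/funext => y; exact: normal_pdf01E.
apply: is_derive_eq.
rewrite !scaler0 /GRing.scale/=; lra.
Qed.

End real_analysis.

Section stein_equation.
Variables (R : realType) (g : R -> R) (A L : R).
Local Open Scope classical_set_scope.
Local Notation mu := (@lebesgue_measure R).
Local Notation phi := (@normal_pdf R 0 1).
Hypothesis g_lip : forall x y, `|g x - g y| <= L * `|x - y|.
Hypothesis g_supp : forall x, A <= `|x| -> g x = 0.

Lemma integrable_mul_pdf : mu.-integrable setT (EFin \o (fun x => g x * phi x)).
Proof.
have cg := lipschitz_continuous g_lip.
have [B B0 gB] := compact_support_bounded cg g_supp.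
apply: (@le_integrable _ _ _ mu setT measurableT _
  (fun x => (B%:E * (phi x)%:E)%E)).
- apply/measurable_EFinP/measurable_funM; last exact: measurable_normal_pdf.
  exact: continuous_measurable_fun.
- move=> x _; rewrite /= lee_fin !normrM (ger0_norm B0).
  by rewrite ler_wpM2r.
- by apply: integrableZl => //; exact: integrable_normal_pdf.
Qed.

Hypothesis g_mean0 : (\int[mu]_x (g x * phi x))%R = 0.

(** Stein's equation is the derivative rule for [K / phi], because [phi] has derivative
    [- x * phi x]. *)
Let K x := (\int[mu]_(t in `]-oo, x]) (g t * phi t))%R.

Let continuous_gphi : continuous (fun x => g x * phi x).
Proof.
move=> x; apply: cvgM; first exact: (lipschitz_continuous g_lip).
exact: continuous_normal_pdf.
Qed.

Let K_derive (x : R) : is_derive x 1 K (g x * phi x).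
Proof.
have x1 : x < x + 1 by rewrite ltrDl.
have ig : mu.-integrable `]-oo, (x + 1)] (EFin \o (fun x => g x * phi x)).
  exact: integrableS integrable_mul_pdf.
have [|dK K'] := continuous_FTC1 x1 ig _ (@continuous_gphi x).
  exact: ltNyr.
apply: DeriveDef; [exact: dK|rewrite -derive1E; exact: K'].
Qed.

(** To the left of the support the integrand vanishes. To the right, mean zero makes [K x] the
    opposite of the integral over []x, +oo[], which vanishes too. *)
Let K_supp (x : R) : A <= `|x| -> K x = 0.
Proof.
have [x0|x0] := ltP x 0.
  rewrite ltr0_norm// => Ax; rewrite /K /Rintegral integral0_eq// => t /=.
  rewrite in_itv/= => tx; rewrite g_supp ?mul0r//.
  by rewrite ler0_norm ?(le_trans Ax) ?lerN2// (le_trans tx)// ltW.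
rewrite ger0_norm// => Ax.
have := @Rintegral_itvB R (fun x => g x * phi x) -oo%O +oo%O x.
rewrite set_itvNyy g_mean0 -/(K x) => /(_ integrable_mul_pdf isT isT).
rewrite /Rintegral integral0_eq/=; first lra.
move=> t /=; rewrite in_itv/= andbT => xt; rewrite g_supp ?mul0r//.
by rewrite (le_trans Ax)// (le_trans (ltW xt))// ler_norm.
Qed.

(** Compact support of [K / phi] gives all bounds by continuity, without Gaussian tail estimates. *)
Lemma stein_solution : exists f f' : R -> R, exists M,
  [/\ 0 <= M, forall x, f' x - x * f x = g x, forall x, `|f' x| <= M &
      forall x u, `|f x - f (x - u) - u * f' x| <= M * u ^+ 2].
Proof.
pose f x := K x / phi x; pose f' x := x * f x + g x.
have phi_neq0 x : phi x != 0 by rewrite gt_eqF ?normal_pdf01_gt0.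
have df (x : R) : is_derive x 1 f (f' x).
  have dphi := is_derive_normal_pdf01 x.
  have dV := is_deriveV (phi_neq0 x) dphi.
  apply: (is_derive_eq (is_deriveM (K_derive x) dV)).
  rewrite /f' /f /GRing.scale/=; field; exact: phi_neq0.
have f_supp x : A <= `|x| -> f x = 0 by move=> Ax; rewrite /f K_supp// mul0r.
have cf : continuous f by exact: is_derive_continuous df.
have cg := lipschitz_continuous g_lip.
have cf' : continuous f'.
  by move=> x; apply: cvgD; [apply: cvgM; [exact: cvg_id|exact: cf]|exact: cg].
have f'_supp x : A <= `|x| -> f' x = 0.
  by move=> Ax; rewrite /f' f_supp// g_supp// mulr0 addr0.
have [M1 M10 f'M1] := compact_support_bounded cf' f'_supp.
(* Since [g] is only Lipschitz, [f'] is not differentiated: its part [x * f x] has the bounded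
   derivative [q'], and [g] adds [L] to the Lipschitz constant. *)
pose q' x := f x + x * f' x.
have dq (x : R) : is_derive x 1 (fun x => x * f x) (q' x).
  by apply: is_derive_eq; rewrite /q' /GRing.scale/=; ring.
have [M2 M20 q'M2] : exists2 M2, 0 <= M2 & forall x, `|q' x| <= M2.
  apply: (@compact_support_bounded _ _ A).
    move=> x; apply: cvgD; first exact: cf.
    by apply: cvgM; [exact: cvg_id|exact: cf'].
  by move=> x Ax; rewrite /q' f_supp// f'_supp// mulr0 addr0.
have L0 : 0 <= L.
  by have := le_trans (normr_ge0 _) (g_lip 1 0); rewrite subr0 normr1 mulr1.
have M0 : 0 <= M1 + M2 + L by rewrite !addr_ge0.
exists f, f', (M1 + M2 + L); split=> //.
- by move=> x; rewrite /f' addrAC subrr add0r.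
- by move=> x; apply: le_trans (f'M1 x) _; lra.
apply: taylor_lipschitz => // x y.
apply: (@le_trans _ _ ((M2 + L) * `|x - y|)); last by rewrite ler_wpM2r//; lra.
have -> : f' x - f' y = (x * f x - y * f y) + (g x - g y) by rewrite /f'; ring.
rewrite mulrDl; apply: le_trans (ler_normD _ _) _; rewrite lerD ?g_lip//.
exact: (derive_bounded_lipschitz dq).
Qed.

End stein_equation.

(** * The number of d-descents *)

Section uniform_permutation.
Variables (R : realType) (n : nat).
Local Open Scope classical_set_scope.

Lemma integrable_uniform_perm (F : 'S_n -> R) :
  (uniform_perm R n).-integrable setT (EFin \o F).
Proof.
apply: measurable_bounded_integrable => //.
  by rewrite -ge0_fin_numE// fin_num_measure.
exists (\sum_q `|F q|); split; first exact: num_real.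
move=> x Fx p _; apply: le_trans (ltW Fx).
by rewrite (bigD1 p)//= lerDl sumr_ge0.
Qed.

(** [F] is a finite combination of indicators of singletons, so all later computations reduce to
    finite means. *)
Lemma integral_uniform_perm (F : 'S_n -> R) :
  (\int[uniform_perm R n]_p (F p)%:E = (mean F)%:E)%E.
Proof.
transitivity (\int[uniform_perm R n]_p
    (\sum_(q : 'S_n) (F q * \1_[set q] p)%:E))%E.
  apply: eq_integral => p _.
  rewrite sumEFin (bigD1 p)//= indicE mem_set// mulr1 big1 ?addr0// => q qp.
  by rewrite indicE memNset ?mulr0//= => pq; rewrite pq eqxx in qp.
rewrite integral_sum//=; last by move=> q; exact: integrable_uniform_perm.
rewrite /mean mulr_suml -sumEFin; apply: eq_bigr => q _.
under eq_integral do rewrite EFinM.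
rewrite integralZl//=; last exact: integrable_uniform_perm.
rewrite integral_indic//= setIT.
have -> : [set q] = [set` [set q]%SET].
  by apply/seteqP; split => p /=; rewrite inE => /eqP.
by rewrite uniform_permE cards1 mul1r -EFinM.
Qed.

End uniform_permutation.

Lemma leq_card_iota (T : finType) (B : {set T}) (f : T -> nat) (m d : nat) :
  {in B &, injective f} -> (forall b, b \in B -> m <= f b < m + d)%N ->
  (#|B| <= d)%N.
Proof.
move=> f_inj f_range.
rewrite cardE -(size_map f) -[leqRHS](size_iota m).
apply: uniq_leq_size.
  rewrite map_inj_in_uniq ?enum_uniq// => b c.
  by rewrite !mem_enum; exact: f_inj.
by move=> k /mapP[b]; rewrite mem_enum mem_iota => bB ->; exact: f_range.
Qed.

(** * Pairs of positions at distance at most [d] *)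

Section window_pairs.
Variables (d n : nat).

Definition window_pairs : {set 'I_n * 'I_n} :=
  [set e : 'I_n * 'I_n | (e.1 < e.2 <= e.1 + d)%N]%SET.

Lemma window_pairs_oriented a : a \in window_pairs -> oriented a.
Proof. by rewrite inE => /andP[]. Qed.

(** Each end of [a] is the left end of at most [d] window pairs and the right end of at most [d]. *)
Lemma window_pairs_degree a :
  (\sum_(b in window_pairs | adj a b) 1 <= 4 * d)%N.
Proof.
have deg1 (v : 'I_n) : (\sum_(b in window_pairs) (v == b.1) <= d)%N.
  rewrite -big_mkcondr sum1dep_card/=.
  apply: (@leq_card_iota _ _ (fun b : 'I_n * 'I_n => b.2 : nat) v.+1)
    => [[i j] [k l]|b]/=.
    rewrite !inE/= => /andP[_ /eqP <-] /andP[_ /eqP <-] jl.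
    by congr pair; exact: val_inj.
  by rewrite !inE => /andP[/andP[bb bd] /eqP ->]; lia.
have deg2 (v : 'I_n) : (\sum_(b in window_pairs) (v == b.2) <= d)%N.
  rewrite -big_mkcondr sum1dep_card/=.
  (* For [v < d] the difference truncates to 0, and the left ends, being below [v], still lie below
     [d]. *)
  apply: (@leq_card_iota _ _ (fun b : 'I_n * 'I_n => b.1 : nat) (v - d)%N)
    => [[i j] [k l]|b]/=.
    rewrite !inE/= => /andP[_ /eqP <-] /andP[_ /eqP <-] jl.
    by congr pair; exact: val_inj.
  by rewrite !inE => /andP[/andP[bb bd] /eqP ->]; lia.
apply: (@leq_trans (\sum_(b in window_pairs)
    ((a.1 == b.1) + (a.1 == b.2) + (a.2 == b.1) + (a.2 == b.2)))%N).
  rewrite big_mkcondr/=; apply: leq_sum => b _; rewrite /adj.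
  by do 4 case: (_ == _).
rewrite !big_split/= !mulSn mul0n addn0 !addnA.
by rewrite !leq_add.
Qed.

End window_pairs.

(** As [d] is positive, all consecutive pairs [(i, i + 1)] belong to the window. *)
Lemma card_window_pairs (d n : nat) : (0 < d)%N ->
  (n.-1 <= #|window_pairs d n|)%N.
Proof.
case: n => // m d0; rewrite -[leqLHS]card_ord.
pose f (i : 'I_m) : 'I_m.+1 * 'I_m.+1 := (widen_ord (leqnSn m) i, lift ord0 i).
have f_inj : injective f.
  move=> i j fij; apply: val_inj.
  exact: (congr1 (fun e : 'I_m.+1 * 'I_m.+1 => val e.1) fij).
rewrite -(card_imset _ f_inj); apply: subset_leq_card; apply/fintype.subsetP.
by move=> _ /imsetP[i _ ->]; rewrite inE/= /bump/=; lia.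
Qed.

(** * Moments and distribution function of the standardized count *)

Section standardized_d_descents.
Variables (R : realType) (d n : nat).
Hypotheses (d_gt0 : (0 < d)%N) (n_gt1 : (1 < n)%N).

Local Notation P := (uniform_perm R n).
Local Notation X := (num_dDescents R d n).
Local Notation E := (window_pairs d n).
Local Notation S := (cmp_sum R E).

Definition sd : R := Num.sqrt (cmp_var R E).

Definition standardized p : R := S p / sd.

Lemma num_dDescentsE p : X p = S p + #|E|%:R / 2.
Proof.
rewrite /num_dDescents /cmp_sum /xi /cmp sumrB sumr_const.
rewrite -[2^-1 *+ _]mulr_natl subrK -sum1_card -natr_sum; congr _%:R.
rewrite [RHS]big_mkcond [LHS]big_mkcond/=; apply: eq_bigr => e _.
by rewrite !inE; do 3 case: (_ < _)%N => //; case: (_ <= _)%N.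
Qed.

Lemma expectation_num_dDescents : ('E_P[X] = (#|E|%:R / 2)%:E)%E.
Proof.
rewrite expectation_def integral_uniform_perm; congr _%:E.
rewrite (eq_mean num_dDescentsE) meanD mean_cst mean_cmp_sum ?add0r//.
exact: window_pairs_oriented.
Qed.

Lemma variance_num_dDescents : ('V_P[X] = (cmp_var R E)%:E)%E.
Proof.
rewrite /variance covariance.unlock expectation_num_dDescents/=.
rewrite expectation.unlock.
rewrite (integral_uniform_perm
  (fun p => (X p - #|E|%:R / 2) * (X p - #|E|%:R / 2))).
congr _%:E.
rewrite -mean_cmp_sum2//; last exact: window_pairs_oriented.
by apply: eq_mean => p; rewrite num_dDescentsE addrK.
Qed.

Lemma standardize_num_dDescents p : standardize P X p = standardized p.
Proof.
rewrite /standardize expectation_num_dDescents variance_num_dDescents/=.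
by rewrite num_dDescentsE addrK.
Qed.

Lemma cdf_num_dDescents x :
  cdf (standardize P X : {RV P >-> R}) x =
  (mean (fun p => (standardized p <= x)%R%:R))%:E.
Proof.
transitivity (P [set` [set p | (standardized p <= x)%R]%SET]%classic).
  congr (P _); apply/seteqP; split=> p /=;
    by rewrite in_itv/= standardize_num_dDescents inE.
rewrite uniform_permE /mean; congr (_ / _)%:E.
rewrite -sum1_card natr_sum big_mkcond/=; apply: eq_bigr => p _.
by rewrite inE; case: ifP.
Qed.

Lemma cmp_var_window_ge : (n.-1)%:R / 12 <= cmp_var R E.
Proof.
apply: le_trans (cmp_var_ge R E).
by rewrite ler_pM2r ?invr_gt0// ler_nat card_window_pairs.
Qed.

Lemma sd2E : sd ^+ 2 = cmp_var R E.
Proof.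
by rewrite sqr_sqrtr// (le_trans _ cmp_var_window_ge)// divr_ge0.
Qed.

Lemma sd_gt0 : 0 < sd.
Proof.
rewrite sqrtr_gt0 (lt_le_trans _ cmp_var_window_ge)// divr_gt0// ltr0n.
by case: n n_gt1 => [|[]].
Qed.

Lemma mean_standardized2 : mean (fun p => standardized p ^+ 2) = 1.
Proof.
rewrite (eq_mean (G := fun p => sd ^- 2 * (S p * S p))).
  rewrite meanZ mean_cmp_sum2 -?sd2E ?mulVf ?sqrf_eq0 ?gt_eqF ?sd_gt0//.
  exact: window_pairs_oriented.
by move=> p; rewrite /standardized exprMn exprVn mulrC -expr2.
Qed.

End standardized_d_descents.

(** * Convergence to the normal distribution *)

Section trapezoid.
Variables (R : realFieldType) (a b w : R).
Hypothesis w_gt0 : 0 < w.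
Implicit Types x y : R.

(* The value is 1 on [[a, b]], 0 outside [[a - w, b + w]], affine in between. *)
Definition trapezoid x : R :=
  Num.max 0 (Num.min 1 (1 + Num.min (x - a) (b - x) / w)).

Lemma trapezoid_ge0 x : 0 <= trapezoid x.
Proof. by rewrite le_max lexx. Qed.

Lemma trapezoid_le1 x : trapezoid x <= 1.
Proof. by rewrite ge_max ler01 ge_min lexx. Qed.

Lemma trapezoid_in x : a <= x -> x <= b -> trapezoid x = 1.
Proof.
move=> ax xb; rewrite /trapezoid (min_idPl _) ?(max_idPr _)// lerDl.
by rewrite divr_ge0 ?(ltW w_gt0)// le_min !subr_ge0 ax.
Qed.

Lemma trapezoid_out x : x <= a - w \/ b + w <= x -> trapezoid x = 0.
Proof.
move=> xab; apply/max_idPl; rewrite ge_min; apply/orP; right.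
rewrite -lerBrDl sub0r ler_pdivrMr// mulN1r ge_min.
by case: xab => h; apply/orP; [left|right]; lra.
Qed.

(** The support in the symmetric form that the solution of Stein's equation takes as input. *)
Lemma trapezoid_supp x : `|a| + `|b| + w <= `|x| -> trapezoid x = 0.
Proof.
move=> abx; apply: trapezoid_out.
have := ler_norm b; have := ler_norm (- a); rewrite normrN.
have := normr_ge0 a; have := normr_ge0 b.
have [x0|x0] := leP 0 x.
  by rewrite (ger0_norm x0) in abx; move=> *; right; lra.
by rewrite (ltr0_norm x0) in abx; move=> *; left; lra.
Qed.

(** Clamping to [[0, 1]] and taking a minimum do not increase distances, so only the slope [w^-1]
    remains. *)
Lemma trapezoid_lipschitz x y :
  `|trapezoid x - trapezoid y| <= w^-1 * `|x - y|.
Proof.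
have clamp u v : `|Num.max 0 (Num.min 1 u) - Num.max 0 (Num.min 1 v)| <=
    `|u - v| :> R.
  rewrite ler_norml; have := ler_norm (u - v); have := ler_norm (- (u - v)).
  rewrite normrN /Num.max /Num.min.
  by case: (ltP 1 u); case: (ltP 1 v); rewrite ?ltr01;
    case: (ltP 0 u); case: (ltP 0 v); lra.
apply: le_trans (clamp _ _) _.
rewrite opprD addrACA subrr add0r -mulrBl normrM mulrC.
rewrite (gtr0_norm (x := w^-1)) ?invr_gt0//.
rewrite ler_pM2l ?invr_gt0//.
rewrite ler_norml; have := ler_norm (x - y); have := ler_norm (- (x - y)).
rewrite normrN /Num.min.
by case: (ltP (x - a)); case: (ltP (y - a)); lra.
Qed.

End trapezoid.

(** * Gaussian means of compactly supported Lipschitz functions *)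

Section gauss_mean.
Variable R : realType.
Local Open Scope classical_set_scope.
Implicit Types (h : R -> R) (A L a b x : R).
Local Notation mu := (@lebesgue_measure R).
Local Notation phi := (@normal_pdf R 0 1).
Local Notation gauss := (@normal_prob R 0 1).

Definition gauss_mean h : R := (\int[mu]_x (h x * phi x))%R.

Lemma gauss_mean_le1 h A L : (forall x y, `|h x - h y| <= L * `|x - y|) ->
  (forall x, A <= `|x| -> h x = 0) -> (forall x, h x <= 1) -> gauss_mean h <= 1.
Proof.
move=> h_lip h_supp h1.
have <- : (\int[mu]_x phi x)%R = 1 by rewrite /Rintegral integral_normal_pdf.
apply: le_Rintegral => //.
- exact: integrable_mul_pdf h_lip h_supp.
- exact: integrable_normal_pdf.
- by move=> x _; rewrite ler_piMl// normal_pdf_ge0.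
Qed.

Lemma gauss_mean_ge h A L a b : (forall x y, `|h x - h y| <= L * `|x - y|) ->
  (forall x, A <= `|x| -> h x = 0) -> (forall x, 0 <= h x) ->
  (forall x, a <= x -> x <= b -> 1 <= h x) ->
  fine (gauss `]-oo, b]) - fine (gauss `]-oo, a]) <= gauss_mean h.
Proof.
move=> h_lip h_supp h0 h1.
have ih := integrable_mul_pdf h_lip h_supp.
have mphi : measurable_fun setT (fun x => (phi x)%:E).
  by apply/measurable_EFinP; exact: measurable_normal_pdf.
have fG t : (fine (gauss `]-oo, t]))%:E = gauss `]-oo, t].
  by rewrite fineK// fin_num_measure.
rewrite lerBlDr -lee_fin EFinD !fG.
rewrite /gauss_mean /Rintegral fineK ?integrable_fin_num//.
(* This covering holds for all [a] and [b]: if [b < a], the second interval is empty. *)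
apply: (@le_trans _ _ (gauss (`]-oo, a] `|` `]a, b]))).
  apply: le_measure; rewrite ?inE//; first exact: measurableU.
  move=> x /=; rewrite !in_itv/= => xb.
  by have [xa|ax] := leP x a; [left|right].
apply: (le_trans (measureU2 _ _ _)) => //.
rewrite [leRHS]addeC; apply: leeD; first exact: lexx.
apply: (@le_trans _ _ (\int[mu]_(x in `]a, b]) (h x * phi x)%:E)%E).
  apply: ge0_le_integral => //.
  - by move=> x _; rewrite lee_fin normal_pdf_ge0.
  - exact: measurable_funTS.
  - by apply: measurable_funTS; exact: (measurable_int mu).
  - move=> x /=; rewrite in_itv/= => /andP[ax xb].
    by rewrite lee_fin ler_peMl ?normal_pdf_ge0// h1// ltW.
apply: ge0_subset_integral => //.
- exact: (measurable_int mu).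
- by move=> x _; rewrite lee_fin mulr_ge0// normal_pdf_ge0.
Qed.

Lemma gauss_meanB h k c A L L' :
  (forall x y, `|h x - h y| <= L * `|x - y|) ->
  (forall x, A <= `|x| -> h x = 0) ->
  (forall x y, `|k x - k y| <= L' * `|x - y|) ->
  (forall x, A <= `|x| -> k x = 0) ->
  gauss_mean (fun x => h x - c * k x) = gauss_mean h - c * gauss_mean k.
Proof.
move=> h_lip h_supp k_lip k_supp.
have ih := integrable_mul_pdf h_lip h_supp.
have ik := integrable_mul_pdf k_lip k_supp.
rewrite /gauss_mean -RintegralZl// -RintegralB//.
  by apply: eq_Rintegral => x _; rewrite mulrBl mulrA.
have := @integrableZl _ _ _ mu setT measurableT c _ ik.
by apply: eq_integrable.
Qed.

End gauss_mean.

(** * Limits of means of test functions *)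

Section normal_limit.
Variables (R : realType) (d : nat).
Hypothesis d_gt0 : (0 < d)%N.
Local Open Scope classical_set_scope.

Lemma sd_cvgy (K : R) : \forall n \near \oo, K <= sd R d n.
Proof.
(* Passing to [|K|] allows squares to be compared; then [12 * K ^+ 2 <= n - 1] is enough. *)
near=> n; apply: le_trans (ler_norm K) _.
rewrite -[leLHS]ger0_norm// -[leRHS]ger0_norm ?sqrtr_ge0//.
rewrite -ler_sqr ?nnegrE// !real_normK ?num_real// sd2E//.
apply: le_trans (cmp_var_window_ge R n d_gt0).
rewrite ler_pdivlMr// -subn1 natrB; last by near: n; exact: nbhs_infty_ge.
by rewrite lerBrDr; near: n; exact: nbhs_infty_ger.
Unshelve. all: by end_near. Qed.

(** By Stein's equation the mean is at most [K / sd R d n], where [K] does not depend on [n] because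
    the degree bound [4 * d] does not. *)
Lemma standardized_stein (g : R -> R) (A L e : R) :
  (forall x y, `|g x - g y| <= L * `|x - y|) ->
  (forall x, A <= `|x| -> g x = 0) -> gauss_mean g = 0 -> 0 < e ->
  \forall n \near \oo, `|mean (fun p : 'S_n => g (standardized R d p))| <= e.
Proof.
move=> g_lip g_supp g_mean0 e0.
have [f [f' [M [M0 fg f'M f_taylor]]]] := stein_solution g_lip g_supp g_mean0.
pose D : R := (4 * d)%N%:R.
pose K := M * (24 * D ^+ 3 + 12 * D ^+ 2 + 1).
near=> n.
have n1 : (1 < n)%N by near: n; exact: nbhs_infty_gt.
have s0 := sd_gt0 R d_gt0 n1.
apply: (@le_trans _ _ (K / sd R d n)); last first.
  rewrite ler_pdivrMr// -ler_pdivrMl// mulrC; near: n; exact: sd_cvgy.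
have <- : mean (fun p : 'S_n => f' (standardized R d p) -
    standardized R d p * f (standardized R d p)) =
    mean (fun p : 'S_n => g (standardized R d p)).
  by apply: eq_mean => p; rewrite fg.
apply: stein_bound => //.
- exact: window_pairs_oriented.
- exact: window_pairs_degree.
- exact: sd2E.
Unshelve. all: by end_near. Qed.

(** A one-sided bound is enough, as it will be applied to trapezoids below the indicators of both
    half-lines. *)
Lemma standardized_liminf (h : R -> R) (A L e : R) :
  (forall x y, `|h x - h y| <= L * `|x - y|) ->
  (forall x, A <= `|x| -> h x = 0) -> (forall x, 0 <= h x <= 1) -> 0 < e ->
  \forall n \near \oo,
    gauss_mean h - e <= mean (fun p : 'S_n => h (standardized R d p)).
Proof.
move=> h_lip h_supp h01 e0.
have h0 x : 0 <= h x by case/andP: (h01 x).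
(* A nonpositive Gaussian mean makes the bound trivial; a positive one forces [gauss_mean k] to be
   positive, so that [c] can be formed. *)
have [Nh0|Nh0] := leP (gauss_mean h) 0.
  near=> n; apply: (@le_trans _ _ 0); first lra.
  by rewrite -(mean_cst n (0 : R)); apply: le_mean.
(* [A <= B] ensures [h <= k], while [1 <= B] and [2 / e <= B] give [B ^- 2 <= e / 2] for Chebyshev's
   inequality. *)
pose B := Num.max A (Num.max 1 (2 / e)).
have BA : A <= B by rewrite le_max lexx.
have B1 : 1 <= B by rewrite !le_max lexx orbT.
have Be : 2 / e <= B by rewrite !le_max lexx !orbT.
have B0 : 0 < B by lra.
pose k := trapezoid (- B) B 1.
have k_lip := trapezoid_lipschitz (- B) B (@ltr01 R).
have k_supp := @trapezoid_supp R (- B) B 1 ltr01.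
pose A' := Num.max A (`|- B| + `|B| + 1).
have A1 : A <= A' by rewrite le_max lexx.
have A2 : `|- B| + `|B| + 1 <= A' by rewrite le_max lexx orbT.
have h_supp' x : A' <= `|x| -> h x = 0 by move=> /(le_trans A1); exact: h_supp.
have k_supp' x : A' <= `|x| -> k x = 0 by move=> /(le_trans A2); exact: k_supp.
have k_in x : `|x| <= B -> k x = 1.
  by rewrite ler_norml => /andP[]; exact: trapezoid_in.
have hk x : h x <= k x.
  have [xB|Bx] := leP `|x| B; first by rewrite k_in//; case/andP: (h01 x).
  by rewrite h_supp ?trapezoid_ge0// (le_trans BA)// ltW.
have Nk1 : gauss_mean k <= 1.
  by apply: gauss_mean_le1 k_lip k_supp _ => x; exact: trapezoid_le1.
have Nk0 : 0 < gauss_mean k.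
  apply: lt_le_trans Nh0 _; apply: le_Rintegral => //.
  - exact: integrable_mul_pdf h_lip h_supp.
  - exact: integrable_mul_pdf k_lip k_supp.
  - by move=> x _; rewrite ler_wpM2r// normal_pdf_ge0.
pose c := gauss_mean h / gauss_mean k.
have c0 : 0 <= c by rewrite divr_ge0// ltW.
have g_lip x y : `|(h x - c * k x) - (h y - c * k y)| <= (L + c) * `|x - y|.
  have -> : (h x - c * k x) - (h y - c * k y) = (h x - h y) - c * (k x - k y).
    by ring.
  apply: le_trans (ler_normB _ _) _; rewrite mulrDl lerD// normrM ger0_norm//.
  by rewrite ler_wpM2l// (le_trans (k_lip x y))// invr1 mul1r.
have g_supp x : A' <= `|x| -> h x - c * k x = 0.
  by move=> Ax; rewrite h_supp'// k_supp'// mulr0 subrr.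
have g_mean0 : gauss_mean (fun x => h x - c * k x) = 0.
  rewrite (gauss_meanB c h_lip h_supp' k_lip k_supp').
  by rewrite /c divfK ?subrr// gt_eqF.
have e2 : 0 < e / 2 by lra.
near=> n.
have n1 : (1 < n)%N by near: n; exact: nbhs_infty_gt.
have : `|mean (fun p : 'S_n =>
    h (standardized R d p) - c * k (standardized R d p))|
    <= e / 2.
  by near: n; exact: standardized_stein g_lip g_supp g_mean0 e2.
rewrite meanB meanZ ler_norml => /andP[+ _].
(* Chebyshev: pointwise [k x >= 1 - x ^+ 2 / B ^+ 2], and the standardized second moment is 1. *)
have mk : 1 - e / 2 <= mean (fun p : 'S_n => k (standardized R d p)).
  apply: (@le_trans _ _ (mean (fun p : 'S_n =>
      1 - B ^- 2 * standardized R d p ^+ 2))).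
    rewrite meanB meanZ mean_cst (mean_standardized2 R d_gt0 n1) mulr1.
    rewrite lerD2l lerN2 -[leRHS]invrK lef_pV2 ?posrE ?invr_gt0 ?exprn_gt0//.
    by rewrite invf_div (le_trans Be)// expr2 ler_peMl// ltW.
  apply: le_mean => p; set x := standardized R d p.
  have [xB|Bx] := leP `|x| B.
    rewrite k_in// gerBl mulr_ge0 ?sqr_ge0// invr_ge0 sqr_ge0//.
  apply: le_trans (trapezoid_ge0 _ _ _ _); rewrite subr_le0.
  rewrite mulrC ler_pdivlMr ?exprn_gt0// mul1r -[leRHS]real_normK ?num_real//.
  by rewrite lerXn2r ?nnegrE// ltW.
have ch : gauss_mean h <= c by rewrite ler_pdivlMr// ler_piMr// ltW.
have ch1 : gauss_mean h <= 1.
  by apply: gauss_mean_le1 h_lip h_supp _ => x; case/andP: (h01 x).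
set m := mean _ in mk *.
have m0 : 0 <= m.
  by rewrite -(mean_cst n (0 : R)); apply: le_mean => p; exact: trapezoid_ge0.
(* The mean of [h] is at least [c * m - e / 2]; replacing [c] by [gauss_mean h] and [m] by
   [1 - e / 2] loses at most another [e / 2]. *)
have : gauss_mean h * m <= c * m by rewrite ler_wpM2r.
have : gauss_mean h * (1 - e / 2) <= gauss_mean h * m.
  by rewrite ler_wpM2l// ltW.
have : gauss_mean h * (e / 2) <= e / 2 by rewrite ler_piMl// ltW.
lra.
Unshelve. all: by end_near. Qed.

End normal_limit.

Section gauss_cdf.
Variable R : realType.
Local Open Scope classical_set_scope.

Definition gauss_cdf (t : R) : R := fine (normal_prob (0 : R) 1 `]-oo, t]).

(** As a random variable under the Gaussian law, the identity has distribution function [gauss_cdf],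
    so the general limits at infinity apply. *)
Let id_mfun : measurableTypeR R -> R := idfun.

HB.instance Definition _ :=
  @isMeasurableFun.Build _ _ _ _ id_mfun (@measurable_id _ _ setT).

Lemma gauss_cdfNy : gauss_cdf t @[t --> -oo] --> (0 : R).
Proof.
exact: fine_cvg (@cvg_cdfNy0 _ _ _ (normal_prob (0 : R) 1)
  (id_mfun : {RV normal_prob (0 : R) 1 >-> R})).
Qed.

Lemma gauss_cdfy : gauss_cdf t @[t --> +oo] --> (1 : R).
Proof.
exact: fine_cvg (@cvg_cdfy1 _ _ _ (normal_prob (0 : R) 1)
  (id_mfun : {RV normal_prob (0 : R) 1 >-> R})).
Qed.

End gauss_cdf.

Theorem theorem2 (R : realType) (d : nat) (d_gt0 : (0 < d)%N) :
  cvg_in_distribution (fun n : nat => uniform_perm R n)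
    (fun n : nat => standardize (uniform_perm R n) (num_dDescents R d n))
    (normal_prob (0 : R)%R (1 : R)%R).
Proof.
move=> x cx; pose Phi := @gauss_cdf R.
have PhiE t : (Phi t)%:E = normal_prob (0 : R) 1 `]-oo, t]%classic.
  by rewrite fineK// fin_num_measure.
have {}cx : (Phi t @[t --> x] --> Phi x)%classic.
  by apply: fine_cvg; rewrite PhiE; exact: cx.
rewrite [X in (_ --> X)%classic](_ : _ = (Phi x)%:E); last by rewrite PhiE.
apply/fine_cvgP; split.
  by apply: nearW => n; rewrite fin_num_measure.
(* Each side costs [3 * q]: continuity at [x], a Gaussian tail, and the limit of the trapezoid
   means. *)
apply/cvgrPdist_le => e e0; pose q := e / 4.
have q0 : 0 < q by rewrite divr_gt0.
have /cvgrPdist_le/(_ _ q0)/nbhs_ballP[r /= r0 xr] := cx.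
have Phi_near t : `|x - t| < r -> `|Phi x - Phi t| <= q.
  exact: xr.
(* The shift [r / 2] is also the width of the trapezoid slopes: a slope falling from [y] or rising
   to [z] reaches 0 exactly at [x]. *)
pose y := x - r / 2; pose z := x + r / 2.
have r2 : 0 < r / 2 by rewrite divr_gt0.
have Phi_y : Phi x - q <= Phi y.
  have : `|Phi x - Phi y| <= q.
    by apply: Phi_near; rewrite subKr gtr0_norm//; lra.
  by rewrite ler_norml => /andP[_]; lra.
have Phi_z : Phi z <= Phi x + q.
  have : `|Phi x - Phi z| <= q.
    by apply: Phi_near; rewrite opprD addNKr normrN gtr0_norm//; lra.
  by rewrite ler_norml => /andP[+ _]; lra.
have [a Phi_a] : exists a, Phi a <= q.
  have /cvgrPdist_le/(_ _ q0)[A [_ HA]] := @gauss_cdfNy R.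
  exists (A - 1); have := HA (A - 1) _; rewrite sub0r normrN => H.
  by apply: le_trans (ler_norm _) (H _); lra.
have [b Phi_b] : exists b, 1 - q <= Phi b.
  have /cvgrPdist_le/(_ _ q0)[B [_ HB]] := @gauss_cdfy R.
  exists (B + 1); have : `|1 - Phi (B + 1)| <= q by apply: HB; lra.
  by rewrite ler_norml => /andP[_]; lra.
have trap01 (u v : R) t : 0 <= trapezoid u v (r / 2) t <= 1.
  by rewrite trapezoid_ge0 trapezoid_le1.
have liminf u v := standardized_liminf d_gt0 (trapezoid_lipschitz u v r2)
  (trapezoid_supp r2) (trap01 u v) q0.
have N_ge u v : Phi v - Phi u <= gauss_mean (trapezoid u v (r / 2)).
  apply: gauss_mean_ge (trapezoid_lipschitz u v r2) (trapezoid_supp r2) _ _.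
    by move=> t; case/andP: (trap01 u v t).
  by move=> t ut tv; rewrite trapezoid_in.
near=> n.
have n1 : (1 < n)%N by near: n; exact: nbhs_infty_gt.
pose m := mean (fun p : 'S_n => (standardized R d p <= x)%R%:R : R).
rewrite [X in `|_ - X|](_ : _ = m); last first.
  rewrite /= -[RHS]/(fine m%:E); congr fine.
  exact: (cdf_num_dDescents d n x).
(* The trapezoid on [[a, y]] lies below the indicator of []-oo, x]]. *)
have lower : Phi y - Phi a - q <= m.
  apply: (@le_trans _ _ (mean (fun p : 'S_n =>
      trapezoid a y (r / 2) (standardized R d p)))).
    apply: (@le_trans _ _ (gauss_mean (trapezoid a y (r / 2)) - q)).
      by rewrite lerD2r.
    by near: n; exact: liminf.
  apply: le_mean => p.
  have [px|xp] := leP (standardized R d p) x; first exact: trapezoid_le1.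
  rewrite trapezoid_out//; right; rewrite /y; lra.
(* The trapezoid on [[z, b]] lies below the indicator of []x, +oo[], whose mean is [1 - m]. *)
have upper : Phi b - Phi z - q <= 1 - m.
  apply: (@le_trans _ _ (mean (fun p : 'S_n =>
      trapezoid z b (r / 2) (standardized R d p)))).
    apply: (@le_trans _ _ (gauss_mean (trapezoid z b (r / 2)) - q)).
      by rewrite lerD2r.
    by near: n; exact: liminf.
  rewrite /m -[X in X - _](mean_cst n) -meanB.
  apply: le_mean => p.
  have [px|xp] := leP (standardized R d p) x.
    rewrite trapezoid_out ?subrr//; left; rewrite /z; lra.
  by rewrite subr0 trapezoid_le1.
have -> : e = 4 * q by rewrite /q; lra.
by rewrite ler_norml; apply/andP; split; lra.
Unshelve. all: by end_near. Qed.
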